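(* Let $r\ge 3$ and let $m\ge r$, $f$ be integers with $0\le f\le\binom{m}{r}$. If $(m,f)\notin\{(r,0),(r,1)\}$, then $\sigma_r(m,f)\le 1-\frac{r!}{r^r}$; otherwise $\sigma_r(m,f)=1$.
   Context: An $r$-graph is an $r$-uniform hypergraph. For integers $r\ge 3$, $m$ and $0\le f\le \binom{m}{r}$, let $S_n^r(m,f)$ be the set of integers $e\in\{0,\dots,\binom nr\}$ such that every $n$-vertex $r$-graph with exactly $e$ edges contains an induced sub-hypergraph on $m$ vertices with exactly $f$ edges, and let $\sigma_r(m,f)=\limsup_{n\to\infty}|S_n^r(m,f)|/\binom{n}{r}$. *)

(* Defs.v *)
From mathcomp Require Import all_boot all_order all_algebra.
From mathcomp Require Import reals ereal topology normedtype sequences.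

Set Implicit Arguments.
Unset Strict Implicit.
Unset Printing Implicit Defensive.

Import GRing.Theory.

(* A hypergraph with vertex type T is given by its set of edges. *)
Definition rgraph (r : nat) (T : finType) (G : {set {set T}}) : bool :=
  [forall e in G, #|e| == r].

Definition induced (T : finType) (G : {set {set T}}) (A : {set T}) :
    {set {set T}} :=
  [set e in G | e \subset A].

Definition has_induced (m f : nat) (T : finType) (G : {set {set T}}) : bool :=
  [exists A : {set T}, (#|A| == m) && (#|induced G A| == f)].

(* The candidate edge numbers 0, ..., 'C(n, r) are the elements of
   'I_('C(n, r)).+1. *)
Definition Sset (r n m f : nat) : {set 'I_('C(n, r)).+1} :=
  [set e : 'I_('C(n, r)).+1 |
    [forall G : {set {set 'I_n}},
      (rgraph r G && (#|G| == e)) ==> has_induced m f G]].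

(* The ratio is 0 for the finitely many n < r, where 'C(n, r) = 0. *)
Definition sigma (R : realType) (r m f : nat) : \bar R :=
  limn_esup (fun n => ((#|Sset r n m f|%:R / 'C(n, r)%:R)%R : R)%:E).

(* Main.v *)
(* If (m, f) is avoided by n-vertex r-graphs with e edges for every
   e <= (n / r)^r, then S_n^r(m, f) has at most 'C(n, r) - (n / r)^r elements,
   which gives the bound.  Apart from (r, 0) and (r, 1) we have m > r, and taking
   complements we may assume 2f >= 'C(m, r).  In an r-partite r-graph an m-set
   spans at most 2^(m - r) edges, so by averaging it spans fewer than half of
   'C(m, r) unless r = 3 and m = 4, where it spans at most 2.  Hence subgraphs of
   the balanced complete r-partite r-graph avoid (m, f), except when
   (r, m, f) = (3, 4, 2).  The pair (4, 2) is avoided by disjoint unions of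
   complete 3-graphs, and a greedy choice of clique sizes realises every
   e <= (n / 3)^3 in this way for large n. *)

From mathcomp Require Import boolp classical_sets realfun.
From mathcomp Require Import all_boot all_order all_algebra.
From mathcomp Require Import reals ereal topology normedtype sequences.
From mathcomp Require Import zify.
Require Import Defs.

Set Implicit Arguments.
Unset Strict Implicit.
Unset Printing Implicit Defensive.
Import Order.TTheory GRing.Theory Num.Theory numFieldNormedType.Exports.

Lemma exists_subset_card (T : finType) (A : {set T}) k :
  k <= #|A| -> exists2 B : {set T}, B \subset A & #|B| = k.
Proof.
rewrite -bin_gt0 -cards_draws => /card_gt0P[B]; rewrite inE => /andP[sBA /eqP].
by exists B.
Qed.

Lemma card_ord_ltn n k : k <= n -> #|[set i : 'I_n | i < k]| = k.
Proof.
by move=> kn; rewrite -sum1dep_card (big_ord_narrow kn) sum1_card card_ord.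
Qed.

Lemma leq_prod_exp2_sum (I : finType) (F : I -> nat) :
  \prod_i F i <= 2 ^ (\sum_i F i - #|I|).
Proof.
have [/forallP Fgt0|/forallPn[i]] := boolP [forall i, 0 < F i]; last first.
  by rewrite -eqn0Ngt (bigD1 i) //= => /eqP ->.
rewrite -sum1_card -sumnB => [|i _]; last exact: Fgt0.
rewrite expn_sum; apply: leq_prod => i _.
by rewrite -[leqLHS](prednK (Fgt0 i)) subn1 ltn_expl.
Qed.

Lemma bin_fact_le_expn n r : 'C(n, r) * r`! <= n ^ r.
Proof.
rewrite bin_ffact ffact_prod -[in leqRHS](card_ord r) -prod_nat_const.
by apply: leq_prod => i _; apply: leq_subr.
Qed.

Definition complete_rgraph (r : nat) (T : finType) (A : {set T}) :
    {set {set T}} :=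
  [set e : {set T} | e \subset A & #|e| == r].

Section InducedSubgraph.
Variables (r : nat) (T : finType).
Implicit Types (A B : {set T}) (F G : {set {set T}}).

Lemma card_complete_rgraph A : #|complete_rgraph r A| = 'C(#|A|, r).
Proof. exact: cards_draws. Qed.

Lemma complete_rgraphS A B :
  A \subset B -> complete_rgraph r A \subset complete_rgraph r B.
Proof.
move=> sAB; apply/subsetP => e; rewrite !inE => /andP[sA ->].
by rewrite (subset_trans sA).
Qed.

Lemma rgraphE G : rgraph r G = (G \subset complete_rgraph r setT).
Proof.
apply/forall_inP/subsetP => rG e eG; first by rewrite inE subsetT rG.
by have := rG e eG; rewrite inE => /andP[].
Qed.

Lemma rgraphS F G : F \subset G -> rgraph r G -> rgraph r F.
Proof. by rewrite !rgraphE; apply: subset_trans. Qed.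

Lemma card_rgraph_edge G e : rgraph r G -> e \in G -> #|e| = r.
Proof. by move=> /forall_inP rG /rG/eqP. Qed.

Lemma inducedT G : induced G setT = G.
Proof. by apply/setP => e; rewrite inE subsetT andbT. Qed.

Lemma inducedS F G A : F \subset G -> induced F A \subset induced G A.
Proof.
by move=> sFG; apply/subsetP => e; rewrite !inE => /andP[/(subsetP sFG) -> ->].
Qed.

Lemma inducedD F G A : induced (F :\: G) A = induced F A :\: induced G A.
Proof.
by apply/setP => e; rewrite !inE; case: (e \subset A); rewrite ?andbF ?andbT.
Qed.

Lemma inducedD1 G A x :
  induced G (A :\ x) = [set e in induced G A | x \notin e].
Proof. by apply/setP => e; rewrite !inE subsetD1 andbA. Qed.

Lemma induced_complete_rgraph A :
  induced (complete_rgraph r setT) A = complete_rgraph r A.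
Proof. by apply/setP => e; rewrite !inE subsetT andbC. Qed.

Lemma induced_sub_complete_rgraph G A :
  rgraph r G -> induced G A \subset complete_rgraph r A.
Proof. by rewrite rgraphE -(induced_complete_rgraph A); apply: inducedS. Qed.

Lemma card_induced_le_bin G A : rgraph r G -> #|induced G A| <= 'C(#|A|, r).
Proof.
move=> rG; rewrite -card_complete_rgraph.
exact: subset_leq_card (induced_sub_complete_rgraph A rG).
Qed.

Lemma card_rgraph_le_bin G : rgraph r G -> #|G| <= 'C(#|T|, r).
Proof. by rewrite -cardsT -{2}[G]inducedT; apply: card_induced_le_bin. Qed.

Definition rgraph_compl G := complete_rgraph r setT :\: G.

Lemma rgraph_rgraph_compl G : rgraph r (rgraph_compl G).
Proof. by rewrite rgraphE subsetDl. Qed.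

Lemma card_induced_compl G A : rgraph r G ->
  #|induced (rgraph_compl G) A| = 'C(#|A|, r) - #|induced G A|.
Proof.
move=> rG; rewrite inducedD induced_complete_rgraph.
by rewrite cardsDS ?card_complete_rgraph ?induced_sub_complete_rgraph.
Qed.

Lemma card_rgraph_compl G :
  rgraph r G -> #|rgraph_compl G| = 'C(#|T|, r) - #|G|.
Proof. by move=> /(card_induced_compl setT); rewrite !inducedT cardsT. Qed.

Lemma has_induced_compl m f G : rgraph r G -> f <= 'C(m, r) ->
  has_induced m ('C(m, r) - f) (rgraph_compl G) = has_induced m f G.
Proof.
move=> rG fC; apply: eq_existsb => A; case: eqVneq fC => [<-|//] fC.
by rewrite card_induced_compl ?eqn_sub2lE ?card_induced_le_bin.
Qed.

Lemma sum_card_inducedD1 G A : rgraph r G ->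
  \sum_(x in A) #|induced G (A :\ x)| = (#|A| - r) * #|induced G A|.
Proof.
move=> rG; under eq_bigr do rewrite inducedD1 -sum1dep_card.
rewrite (exchange_big_dep (mem (induced G A))) /=; last by move=> x e _ /andP[].
rewrite mulnC -sum_nat_const; apply: eq_bigr => e; rewrite inE => /andP[eG sA].
rewrite -(card_rgraph_edge rG eG) -cardsDS// -sum1_card.
by apply: eq_bigl => x; rewrite !inE eG sA andbC.
Qed.

Lemma induced_density_le m k G : rgraph r G ->
  (forall A, #|A| = m -> #|induced G A| <= k) ->
  forall A, m <= #|A| -> #|induced G A| * 'C(m, r) <= k * 'C(#|A|, r).
Proof.
move=> rG le_k A.
have [rm|mr] := leqP r m; last by rewrite (bin_small mr) muln0.
have [n] := ubnP #|A|; elim: n A => // n IH A An mA.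
have [Am|Am] := eqVneq #|A| m; first by rewrite Am leq_mul2r le_k// orbT.
rewrite -(@leq_pmul2l (#|A| - r)); last by lia.
rewrite mulnA -sum_card_inducedD1// mulnCA -mul_bin_down mulnCA.
rewrite -sum_nat_const big_distrl; apply: leq_sum => x xA.
have Ax : #|A :\ x| = #|A|.-1 by rewrite (cardsD1 x A) xA.
by rewrite -Ax; apply: IH; lia.
Qed.

End InducedSubgraph.

Definition transversals (r : nat) (T : finType) (p : T -> 'I_r) :
    {set {set T}} :=
  [set e : {set T} | (#|e| == r) && (p @: e == setT)].

Section Transversals.
Variables (r : nat) (T : finType) (p : T -> 'I_r).
Implicit Types (A : {set T}) (h : {ffun 'I_r -> T}).

Local Notation part A i := [set x in A | p x == i].

Lemma rgraph_transversals : rgraph r (transversals p).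
Proof. by apply/forall_inP => e; rewrite inE => /andP[]. Qed.

Lemma section_transversal h : cancel h p -> h @: setT \in transversals p.
Proof.
move=> hK; rewrite inE card_imset; last exact: can_inj hK.
by rewrite cardsT card_ord eqxx -imset_comp (eq_imset _ hK) imset_id eqxx.
Qed.

Lemma transversal_section e :
  e \in transversals p ->
  exists2 h : {ffun 'I_r -> T}, cancel h p & h @: setT = e.
Proof.
rewrite inE => /andP[/eqP er /eqP peT].
have surj i : exists x, (x \in e) && (p x == i).
  have /imsetP[x xe ->] : i \in p @: e by rewrite peT inE.
  by exists x; rewrite xe eqxx.
pose h := [ffun i => xchoose (surj i)].
have hP i : (h i \in e) && (p (h i) == i).
  by rewrite ffunE; apply: (xchooseP (surj i)).
have hK : cancel h p by move=> i; apply/eqP; case/andP: (hP i).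
exists h => //; apply/eqP; rewrite eqEcard card_imset; last exact: can_inj hK.
rewrite cardsT card_ord er leqnn andbT.
by apply/subsetP => _ /imsetP[i _ ->]; case/andP: (hP i).
Qed.

Lemma family_partsP A h :
  reflect (cancel h p /\ h @: setT \subset A)
          (h \in family (fun i => part A i)).
Proof.
apply: (iffP familyP) => [hA|[hK /subsetP sA] i].
  split=> [i|]; first by have := hA i; rewrite inE => /andP[_ /eqP].
  by apply/subsetP => _ /imsetP[i _ ->]; have := hA i; rewrite inE => /andP[].
by rewrite inE sA ?imset_f// hK eqxx.
Qed.

Lemma induced_transversalsE A :
  induced (transversals p) A =
    [set h @: setT | h : {ffun 'I_r -> T} in family (fun i => part A i)].
Proof.
apply/setP => e; rewrite inE; apply/andP/imsetP => [[eT sA]|].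
  have [h hK he] := transversal_section eT.
  by exists h; [apply/family_partsP; rewrite he|].
by case=> h /family_partsP[hK sA] ->; rewrite section_transversal.
Qed.

Lemma card_induced_transversals A :
  #|induced (transversals p) A| = \prod_i #|part A i|.
Proof.
rewrite induced_transversalsE card_in_imset.
  by rewrite card_family foldrE big_map big_enum.
move=> h k /family_partsP[hK _] /family_partsP[kK _] hk; apply/ffunP => i.
have /imsetP[j _ hi] : h i \in k @: setT by rewrite -hk imset_f.
by rewrite hi -[in LHS](kK j) -hi hK.
Qed.

Lemma sum_card_parts A : \sum_i #|part A i| = #|A|.
Proof.
rewrite -[RHS]sum1_card (partition_big p xpredT)//=; apply: eq_bigr => i _.
by rewrite -sum1dep_card.
Qed.

Lemma card_induced_transversals_le A :
  #|induced (transversals p) A| <= 2 ^ (#|A| - r).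
Proof.
rewrite card_induced_transversals -(sum_card_parts A) -[X in _ - X](card_ord r).
exact: leq_prod_exp2_sum.
Qed.

Lemma card_induced_transversals_lt_half m A :
  2 ^ (m - r).+1 < 'C(m, r) -> m <= #|A| ->
  2 * #|induced (transversals p) A| < 'C(#|A|, r).
Proof.
move=> half mA.
have density : #|induced (transversals p) A| * 'C(m, r) <=
    2 ^ (m - r) * 'C(#|A|, r).
  apply: (induced_density_le rgraph_transversals) => // B <-.
  exact: card_induced_transversals_le.
have C0 : 0 < 'C(m, r) by apply: leq_ltn_trans half.
have CA0 : 0 < 'C(#|A|, r).
  by rewrite bin_gt0 (leq_trans _ mA)// -bin_gt0.
rewrite -(ltn_pmul2r C0) -mulnA.
apply: (@leq_ltn_trans (2 ^ (m - r).+1 * 'C(#|A|, r))).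
  by rewrite expnS -mulnA leq_mul2l.
by rewrite mulnC ltn_pmul2l.
Qed.

End Transversals.

(* Averaging starts from (r + 1)-sets if r > 3, and from 5-sets if r = 3. *)
Lemma card_induced_transversals_lt r m f (T : finType) (p : T -> 'I_r)
    (A : {set T}) :
  3 <= r < m -> 'C(m, r) <= 2 * f -> (r, m, f) != (3, 4, 2) -> #|A| = m ->
  #|induced (transversals p) A| < f.
Proof.
move=> /andP[r3 rm] fC not342 Am; subst m.
have lt_half k : 2 ^ (k - r).+1 < 'C(k, r) -> k <= #|A| ->
    #|induced (transversals p) A| < f.
  move=> half kA; rewrite -(ltn_pmul2l (isT : 0 < 2)).
  exact: leq_trans (card_induced_transversals_lt_half p half kA) fC.
have [r_gt3|r_le3] := ltnP 3 r.
  by apply: (lt_half r.+1); rewrite ?subSnn ?binSn.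
have rE : r = 3 by apply/eqP; rewrite eqn_leq r_le3.
subst r; have [A5|A_le4] := ltnP 4 #|A|; first exact: (lt_half 5).
have A4 : #|A| = 4 by apply/eqP; rewrite eqn_leq A_le4.
have ind_le2 : #|induced (transversals p) A| <= 2.
  by apply: leq_trans (card_induced_transversals_le p A) _; rewrite A4.
apply: leq_ltn_trans ind_le2 _.
by move: not342 fC; rewrite A4 !xpair_eqE /= (_ : 'C(4, 3) = 4)//; lia.
Qed.

Definition residue_mod r (r_gt0 : 0 < r) n (x : 'I_n) : 'I_r :=
  Ordinal (ltn_pmod x r_gt0).

Lemma leq_divn_card_residue r (r_gt0 : 0 < r) n (i : 'I_r) :
  n %/ r <= #|[set x : 'I_n | residue_mod r_gt0 x == i]|.
Proof.
have lt_n (j : 'I_(n %/ r)) : j * r + i < n.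
  have := ltn_ord i; have := ltn_ord j; have := leq_divM n r; nia.
pose f j := Ordinal (lt_n j).
have f_inj : injective f.
  move=> j k /(congr1 val)/eqP /=.
  by rewrite eqn_add2r eqn_pmul2r// => /eqP/val_inj.
rewrite -{1}(card_ord (n %/ r)) -(card_codom f_inj).
apply/subset_leq_card/subsetP => _ /codomP[j ->].
by rewrite inE -val_eqE /= modnMDl modn_small.
Qed.

Lemma leq_expn_divn_card_transversals r (r_gt0 : 0 < r) n :
  (n %/ r) ^ r <= #|transversals (@residue_mod r r_gt0 n)|.
Proof.
rewrite -[transversals _]inducedT card_induced_transversals.
rewrite -[X in _ ^ X](card_ord r) -prod_nat_const; apply: leq_prod => i _.
apply: leq_trans (leq_divn_card_residue r_gt0 n i) _.
by apply/subset_leq_card/subsetP => x; rewrite !inE.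
Qed.

Lemma expn_divn_le_bin n r : 0 < r -> (n %/ r) ^ r <= 'C(n, r).
Proof.
move=> r_gt0; apply: leq_trans (leq_expn_divn_card_transversals r_gt0 n) _.
by rewrite -[n in 'C(n, _)]card_ord card_rgraph_le_bin// rgraph_transversals.
Qed.

(* An r-graph is a vertex-disjoint union of complete r-graphs if and only if
   any two edges that meet span a clique. *)
Definition clique_union (r : nat) (T : finType) (G : {set {set T}}) : Prop :=
  {in G &, forall d e : {set T},
    ~~ [disjoint d & e] -> complete_rgraph r (d :|: e) \subset G}.

Section CliqueUnion.
Variables (r : nat) (T : finType).
Implicit Types (A B V : {set T}) (F G : {set {set T}}).

Lemma clique_union_complete A : clique_union r (complete_rgraph r A).
Proof.
move=> d e; rewrite !inE => /andP[dA _] /andP[eA _] _.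
by apply: complete_rgraphS; rewrite subUset dA.
Qed.

Lemma clique_unionU F G A B : [disjoint A & B] ->
  F \subset complete_rgraph r A -> G \subset complete_rgraph r B ->
  clique_union r F -> clique_union r G -> clique_union r (F :|: G).
Proof.
move=> dAB /subsetP sF /subsetP sG cF cG.
have disj d e : d \in F -> e \in G -> [disjoint d & e].
  move=> /sF + /sG; rewrite !inE => /andP[dA _] /andP[eB _].
  exact: disjointW dA eB dAB.
move=> d e /setUP[dF|dG] /setUP[eF|eG] de.
- exact: subset_trans (cF d e dF eF de) (subsetUl _ _).
- by rewrite disj in de.
- by rewrite disjoint_sym disj in de.
- exact: subset_trans (cG d e dG eG de) (subsetUr _ _).
Qed.

Lemma disjoint_complete_rgraph A B : 0 < r ->
  [disjoint A & B] -> [disjoint complete_rgraph r A & complete_rgraph r B].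
Proof.
move=> r_gt0 dAB; rewrite -setI_eq0 -subset0; apply/subsetP => e; rewrite !inE.
case/andP=> /andP[eA /eqP er] /andP[eB _].
have /card_gt0P[x xe] : 0 < #|e| by rewrite er.
by rewrite -(disjointFr dAB (subsetP eA x xe)) (subsetP eB).
Qed.

Lemma exists_clique_union V (s : seq nat) : 0 < r -> sumn s <= #|V| ->
  exists G, [/\ G \subset complete_rgraph r V, clique_union r G &
                #|G| = \sum_(a <- s) 'C(a, r)].
Proof.
move=> r_gt0; elim: s V => [|a s IH] V /= sV.
  exists set0; rewrite sub0set cards0 big_nil; split=> // d e.
  by rewrite inE.
have [A sAV Aa] := exists_subset_card (leq_trans (leq_addr _ _) sV).
have [|G [sG cG Gs]] := IH (V :\: A).
  by rewrite cardsDS// Aa leq_subRL// -Aa subset_leq_card.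
have dAV : [disjoint A & V :\: A] by rewrite disjoints_subset setCD subsetUr.
exists (complete_rgraph r A :|: G); split.
- rewrite subUset complete_rgraphS//=.
  by rewrite (subset_trans sG)// complete_rgraphS// subsetDl.
- exact: clique_unionU dAV (subxx _) sG (@clique_union_complete A) cG.
- rewrite big_cons -Gs -Aa -card_complete_rgraph.
  apply/eqP; rewrite (leq_card_setU _ _); apply: disjointWr sG _.
  exact: disjoint_complete_rgraph.
Qed.

(* Two distinct r-subsets of an (r + 1)-set meet and cover it. *)
Lemma induced_clique_union G A : 1 < r -> rgraph r G -> clique_union r G ->
  #|A| = r.+1 -> 1 < #|induced G A| -> induced G A = complete_rgraph r A.
Proof.
move=> r_gt1 rG cG Ar /card_gt1P[d [e []]].
rewrite !inE => /andP[dG dA] /andP[eG eA] de.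
have [dr er] := (card_rgraph_edge rG dG, card_rgraph_edge rG eG).
have deA : d :|: e = A.
  apply/eqP; rewrite eqEcard subUset dA eA Ar ltnNge.
  apply: contraNN de => de_r.
  have /eqP -> : d == d :|: e by rewrite eqEcard subsetUl dr.
  by rewrite eq_sym eqEcard subsetUr er.
apply/eqP; rewrite eqEsubset induced_sub_complete_rgraph//=.
apply/subsetP => x xA; rewrite inE; have := xA; rewrite inE => /andP[-> _].
rewrite andbT; apply: (subsetP (cG d e dG eG _)); last by rewrite deA.
rewrite -setI_eq0 -cards_eq0 -lt0n.
by have := cardsUI d e; rewrite deA Ar dr er; lia.
Qed.

End CliqueUnion.

Lemma leq_bin2_bin3_quarter a : 400 < a -> 'C(a, 2) <= 'C((a %/ 4).+1, 3).
Proof.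
move=> a_gt; have [b bE] : exists b, a = b.+1 by exists a.-1; lia.
have [q qE] : exists q, a %/ 4 = q.+1 by exists (a %/ 4).-1; lia.
have := bin_ffact q.+2 3; have := bin_ffact b.+1 2.
rewrite -qE -bE !ffactnS !ffactn0 !factS fact0 /=; move: 'C(a, 2) 'C(_, 3); nia.
Qed.

Lemma expn3_lt_bin3 q : 1 < q -> q ^ 3 < 'C((2 * q).+1, 3).
Proof.
case: q => // q q_gt0; have := bin_ffact (2 * q.+1).+1 3.
have -> : 2 * q.+1 = (2 * q).+2 by lia.
rewrite !ffactnS !ffactn0 !factS fact0 !expnS expn0 /=; move: 'C(_, 3); nia.
Qed.

(* The largest clique that fits leaves fewer than 'C(a, 2) edges, for which the
   next clique has at most a / 4 vertices; so the clique sizes add up to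
   about a + a / 4 + a / 16 + ... = 4 a / 3. *)
Lemma exists_bin3_sum : exists K, forall a e k,
  e < 'C(a.+1, 3) -> 4 * a + K <= 3 * k ->
  exists2 s : seq nat, sumn s <= k & \sum_(b <- s) 'C(b, 3) = e.
Proof.
exists (9 * 'C(401, 3)); elim/ltn_ind => a IH e k ea ak.
have [a_le|a_gt] := leqP a 400.
  exists (nseq e 3); last by rewrite big_nseq iter_addn_0 binn mul1n.
  have : 'C(a.+1, 3) <= 'C(401, 3) by apply: leq_bin2l.
  by rewrite sumn_nseq; move: ak ea; move: 'C(401, 3) => D; lia.
have [ea'|ea'] := ltnP e 'C(a, 3).
  by apply: (IH a.-1) => //; [lia|rewrite prednK//; lia|lia].
have e_lt : e - 'C(a, 3) < 'C((a %/ 4).+1, 3).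
  apply: leq_trans (leq_bin2_bin3_quarter a_gt).
  by move: ea; rewrite binS; lia.
have [||s s_le s_sum] := IH (a %/ 4) _ _ (k - a) e_lt; [by lia|by lia|].
exists (a :: s) => /=; first by lia.
by rewrite big_cons s_sum subnKC.
Qed.

Lemma exists_bin3_sum_le_third : exists N, forall n e,
  N <= n -> e <= (n %/ 3) ^ 3 ->
  exists2 s : seq nat, sumn s <= n & \sum_(b <- s) 'C(b, 3) = e.
Proof.
have [K bin3_sum] := exists_bin3_sum; exists (9 * K + 9) => n e Nn e_le.
apply: (bin3_sum (2 * (n %/ 3))); last by lia.
by apply: leq_ltn_trans e_le (expn3_lt_bin3 _); lia.
Qed.

Section EdgeNumbers.
Variables (r n m f : nat).
Implicit Types (e : 'I_('C(n, r)).+1) (G : {set {set 'I_n}}).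

Lemma SsetP e :
  reflect (forall G, rgraph r G -> #|G| = e -> has_induced m f G)
          (e \in Sset r n m f).
Proof.
rewrite inE; apply: (iffP forallP) => [GS G rG Ge|GS G].
  by apply: implyP (GS G) _; rewrite rG Ge eqxx.
by apply/implyP => /andP[rG /eqP]; apply: GS.
Qed.

Lemma notin_Sset e G :
  rgraph r G -> #|G| = e -> ~~ has_induced m f G -> e \notin Sset r n m f.
Proof. by move=> rG Ge; apply: contraNN => /SsetP; apply. Qed.

Lemma card_Sset_le g : g <= 'C(n, r) ->
  (forall e, e <= g -> e \notin Sset r n m f) ->
  #|Sset r n m f| <= 'C(n, r) - g.
Proof.
move=> gC avoid; have card_low := @card_ord_ltn 'C(n, r).+1 g.+1 gC.
rewrite -subSS -[X in X - _](card_ord 'C(n, r).+1) -card_low.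
rewrite -cardsT -cardsDS ?subsetT//.
apply/subset_leq_card/subsetP => e eS.
by rewrite !inE andbT ltnS; apply: contraL eS; apply: avoid.
Qed.

End EdgeNumbers.

Lemma rev_ord_Sset r n m f e : f <= 'C(m, r) ->
  e \in Sset r n m f -> rev_ord e \in Sset r n m ('C(m, r) - f).
Proof.
move=> fC /SsetP eS; apply/SsetP => G rG Ge.
have G_le := card_rgraph_le_bin rG; rewrite card_ord in G_le.
rewrite -(has_induced_compl rG) ?leq_subr// subKn//.
apply: eS (rgraph_rgraph_compl _ _) _.
by rewrite card_rgraph_compl// card_ord Ge /= subSS subKn// -ltnS.
Qed.

Lemma card_Sset_compl r n m f : f <= 'C(m, r) ->
  #|Sset r n m ('C(m, r) - f)| = #|Sset r n m f|.
Proof.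
move=> fC; rewrite -(card_preimset _ (@rev_ord_inj _)); apply: eq_card => e.
rewrite inE; apply/idP/idP; last exact: rev_ord_Sset.
by move/(rev_ord_Sset (leq_subr _ _)); rewrite rev_ordK subKn.
Qed.

Lemma has_induced_edge r (T : finType) (G : {set {set T}}) e :
  rgraph r G -> e \in G -> has_induced r 1 G.
Proof.
move=> rG eG; have er := card_rgraph_edge rG eG.
apply/existsP; exists e; rewrite er eqxx eqn_leq.
rewrite (leq_trans (card_induced_le_bin e rG)) ?er ?binn//.
by apply/card_gt0P; exists e; rewrite inE eG /=.
Qed.

Lemma has_induced_set0 m f (T : finType) :
  0 < f -> has_induced m f (set0 : {set {set T}}) = false.
Proof.
move=> f_gt0; apply/existsP => -[A]; rewrite (_ : induced _ A = set0).
  by rewrite cards0 [0 == f]ltn_eqF// andbF.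
by apply/setP => e; rewrite !inE.
Qed.

Lemma card_Sset_edge r n : #|Sset r n r 1| = 'C(n, r).
Proof.
suff -> : Sset r n r 1 = [set~ ord0] by rewrite cardsC1 card_ord.
apply/setP => e; rewrite in_setC1; apply/idP/idP.
  apply: contraTneq => ->; apply: (@notin_Sset _ _ _ _ _ set0).
  - by rewrite rgraphE sub0set.
  - by rewrite cards0.
  - by rewrite has_induced_set0.
rewrite -val_eqE -lt0n => e_gt0; apply/SsetP => G rG Ge.
have /card_gt0P[d dG] : 0 < #|G| by rewrite Ge.
exact: has_induced_edge dG.
Qed.

Lemma notin_Sset_transversals r n m f (e : 'I_('C(n, r)).+1) :
  0 < r -> e <= (n %/ r) ^ r ->
  (forall (p : 'I_n -> 'I_r) (A : {set 'I_n}), #|A| = m ->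
     #|induced (transversals p) A| < f) ->
  e \notin Sset r n m f.
Proof.
move=> r_gt0 /leq_trans/(_ (leq_expn_divn_card_transversals r_gt0 n)).
move=> /exists_subset_card[G sG Ge] lt_f.
apply: (notin_Sset (rgraphS sG (rgraph_transversals _)) Ge).
apply/existsPn => A; rewrite negb_and -implybE; apply/implyP => /eqP Am.
rewrite ltn_eqF//.
exact: leq_ltn_trans (subset_leq_card (inducedS A sG)) (lt_f _ A Am).
Qed.

Lemma notin_Sset_clique_union r n f (s : seq nat) (e : 'I_('C(n, r)).+1) :
  1 < f <= r -> sumn s <= n -> \sum_(a <- s) 'C(a, r) = e ->
  e \notin Sset r n r.+1 f.
Proof.
move=> /andP[f_gt1 fr] sn s_e; have r_gt1 := leq_trans f_gt1 fr.
have [||G [sG cG Gs]] := @exists_clique_union r 'I_n setT s; first exact: ltnW.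
  by rewrite cardsT card_ord.
have rG : rgraph r G by rewrite rgraphE.
apply: (notin_Sset rG); first by rewrite Gs.
apply/existsPn => A; apply/negP => /andP[/eqP Ar /eqP indf].
have ind : induced G A = complete_rgraph r A.
  by apply: induced_clique_union => //; rewrite indf.
by have := card_complete_rgraph r A; rewrite -ind indf Ar binSn; lia.
Qed.

Local Open Scope ring_scope.
Local Open Scope classical_set_scope.

Section UpperDensity.
Variable R : realType.

Lemma le_limf_esup (T : choiceType) (X : filteredType T) (F : set_system X)
    (u v : X -> \bar R) : Filter F ->
  (\forall x \near F, u x <= v x)%E -> (limf_esup u F <= limf_esup v F)%E.
Proof.
move=> FF uv; apply: le_ereal_inf_tmp => _ [V FV <-].
pose W := V `&` [set x | u x <= v x]%E.
apply: (@le_trans _ _ (ereal_sup (u @` W))).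
  by apply: ereal_inf_lbound; exists W => //; exact: filterI.
apply: ge_ereal_sup => _ [x [Vx /= uvx] <-]; apply: le_trans uvx _.
by apply: ereal_sup_ubound; exists x.
Qed.

Lemma cvg_invn : n%:R^-1 @[n --> \oo] --> (0 : R).
Proof.
by rewrite -(cvg_shiftS (fun n => n%:R^-1 : R)); apply: cvg_harmonic.
Qed.

Lemma cvg_divn_ratio (r : nat) : (0 < r)%N ->
  (n %/ r)%:R / n%:R @[n --> \oo] --> (r%:R^-1 : R).
Proof.
move=> r_gt0; have r0 : 0 < r%:R :> R by rewrite ltr0n.
apply: (@squeeze_cvgr _ _ _ _ (fun n => r%:R^-1 - n%:R^-1) (fun=> r%:R^-1)).
- exists 1%N => // n /= n_gt0; have n0 : 0 < n%:R :> R by rewrite ltr0n.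
  apply/andP; split.
    rewrite ler_pdivlMr// mulrBl mulVf ?gt_eqF// mulrC lerBlDr natr1.
    by rewrite ler_pdivrMr// -natrM ler_nat ltnW// ltn_ceil.
  by rewrite ler_pdivrMr// mulrC ler_pdivlMr// -natrM ler_nat leq_divM.
- rewrite -[X in _ --> X]subr0.
  by apply: cvgB; [exact: cvg_cst|exact: cvg_invn].
- exact: cvg_cst.
Qed.

Lemma fact_divn_ratio_le (n r : nat) : (0 < r <= n)%N ->
  r`!%:R * ((n %/ r)%:R / n%:R) ^+ r <= ((n %/ r) ^ r)%:R / 'C(n, r)%:R :> R.
Proof.
move=> /andP[r_gt0 rn]; rewrite expr_div_n mulrA -!natrX.
have n0 : 0 < (n ^ r)%:R :> R by rewrite ltr0n expn_gt0 (leq_trans r_gt0).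
have C0 : 0 < 'C(n, r)%:R :> R by rewrite ltr0n bin_gt0.
rewrite ler_pdivrMr// mulrAC ler_pdivlMr// -!natrM ler_nat.
by rewrite mulnAC [leqRHS]mulnC leq_mul2r mulnC bin_fact_le_expn orbT.
Qed.

Lemma cvg_fact_divn_ratio (r : nat) : (0 < r)%N ->
  r`!%:R * ((n %/ r)%:R / n%:R) ^+ r @[n --> \oo] --> (r`!%:R / (r ^ r)%:R : R).
Proof.
move=> r_gt0; rewrite natrX -exprVn; apply: cvgMl_tmp.
exact: cvg_comp (cvg_divn_ratio r_gt0) (@exprn_continuous R r _).
Qed.

Lemma sigma_compl (r m f : nat) : (f <= 'C(m, r))%N ->
  sigma R r m ('C(m, r) - f) = sigma R r m f.
Proof.
by move=> fC; rewrite /sigma; under eq_fun do rewrite card_Sset_compl//.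
Qed.

Lemma sigma_edge (r : nat) : sigma R r r 1 = 1%E.
Proof.
rewrite /sigma; under eq_fun do rewrite card_Sset_edge.
set u := (X in limn_esup X).
suff ul : u @ \oo --> 1%E by have [_ ->] := cvg_limn_einf_sup ul.
apply: cvg_near_cst; exists r => // n /= rn.
by rewrite /u divff// pnatr_eq0 -lt0n bin_gt0.
Qed.

Lemma sigma_le_notin_Sset (r m f : nat) : (0 < r)%N ->
  (\forall n \near \oo, forall e : 'I_('C(n, r)).+1,
     (e <= (n %/ r) ^ r)%N -> e \notin Sset r n m f) ->
  (sigma R r m f <= (1 - r`!%:R / (r ^ r)%:R)%:E)%E.
Proof.
move=> r_gt0 avoid.
pose v n : R := 1 - r`!%:R * ((n %/ r)%:R / n%:R) ^+ r.
have v_cvg : (v n)%:E @[n --> \oo] --> (1 - r`!%:R / (r ^ r)%:R)%:E.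
  apply: cvg_EFin; first exact: nearW.
  by apply: cvgB; [exact: cvg_cst|exact: cvg_fact_divn_ratio].
have [_ <-] := cvg_limn_einf_sup v_cvg.
apply: le_limf_esup; near=> n.
have rn : (r <= n)%N by near: n; exists r.
have C0 : 0 < 'C(n, r)%:R :> R by rewrite ltr0n bin_gt0.
have qC := expn_divn_le_bin n r_gt0.
have S_le : (#|Sset r n m f| <= 'C(n, r) - (n %/ r) ^ r)%N.
  by apply: (card_Sset_le qC); near: n.
rewrite lee_fin; apply: le_trans (_ : 1 - ((n %/ r) ^ r)%:R / 'C(n, r)%:R <= _).
  by rewrite ler_pdivrMr// mulrBl mul1r divfK ?gt_eqF// -natrB// ler_nat.
by rewrite lerB// fact_divn_ratio_le// r_gt0.
Unshelve. all: by end_near. Qed.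

End UpperDensity.

Theorem lemma5p2 (R : realType) (r m f : nat)
    (hr : (3 <= r)%N) (hm : (r <= m)%N) (hf : (f <= 'C(m, r))%N) :
  ((m, f) \notin [:: (r, 0%N); (r, 1%N)] ->
     (sigma R r m f <= (1 - (r`!)%:R / (r ^ r)%:R)%R%:E)%E) /\
  ((m, f) \in [:: (r, 0%N); (r, 1%N)] -> sigma R r m f = 1%E).
Proof.
have r_gt0 : (0 < r)%N by apply: leq_trans hr.
rewrite !inE !xpair_eqE; split=> [mf|]; last first.
  case/orP=> /andP[/eqP -> /eqP ->]; last exact: sigma_edge.
  by rewrite -sigma_compl// binn subn0 sigma_edge.
have rm : (r < m)%N.
  rewrite ltn_neqAle hm andbT; apply: contra mf => /eqP rm.
  by move: hf; rewrite -rm eqxx binn; case: f => [|[]].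
wlog half : f hf {mf} / ('C(m, r) <= 2 * f)%N => [sigma_half|].
  have [/sigma_half|lt_half] := leqP 'C(m, r) (2 * f); first exact.
  by rewrite -sigma_compl//; apply: sigma_half; lia.
apply: sigma_le_notin_Sset => //.
have [[-> -> ->]|not342] := eqVneq (r, m, f) (3, 4, 2)%N.
  have [N bin3_sum] := exists_bin3_sum_le_third; exists N => // n /= Nn e e_le.
  have [s s_le s_sum] := bin3_sum n e Nn e_le.
  exact: notin_Sset_clique_union s_sum.
apply: nearW => n e e_le; apply: notin_Sset_transversals => // p A.
by apply: card_induced_transversals_lt; rewrite ?hr.
Qed.
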